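(* For a commutative Noetherian ring $A$, the pair $(ic(A),* )$ is a commutative cancellative monoid.
   Context: For an ideal $I$ of a commutative Noetherian ring $A$, the integral closure is $\overline{I}=\{x\in A : x^n+a_1x^{n-1}+\dots+a_n=0 \text{ for some } n\ge 1,\ a_i\in I^i\}$; $I$ is integrally closed if $\overline{I}=I$. Define $ic(A)=\{I : I \text{ is an integrally closed ideal of } A \text{ containing a nonzerodivisor}\}$ (the unit ideal $(1)$ is included) and, for $I,J\in ic(A)$, $I*J=\overline{IJ}$. A monoid is a semigroup with identity. Cancellative means that $I*J=I*K$ implies $J=K$ for $I,J,K\in ic(A)$. *)

(* Defs.v *)
From HB Require Import structures.
From mathcomp Require Import all_boot all_algebra.
From mathcomp Require Import boolp classical_sets.

Set Implicit Arguments.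
Unset Strict Implicit.
Unset Printing Implicit Defensive.

Import GRing.Theory.
Local Open Scope classical_set_scope.
Local Open Scope ring_scope.

(* Ideals are Prop-valued sets, so that equality of ideals is Leibniz
   equality.  The library's idealr_closed is not usable here: it requires
   1 \notin I, which excludes the unit ideal.  Rings are comPzRingType, so the
   zero ring is allowed. *)
Definition is_ideal (A : comPzRingType) (I : set A) : Prop :=
  [/\ I 0,
      forall x y, I x -> I y -> I (x + y)
    & forall a x, I x -> I (a * x)].

Definition ideal_span (A : comPzRingType) (S : set A) : set A :=
  smallest (@is_ideal A) S.

Definition noetherian (A : comPzRingType) : Prop :=
  forall I : set A, is_ideal I -> exists s : seq A, I = ideal_span [set` s].

Definition ideal_mul (A : comPzRingType) (I J : set A) : set A :=
  ideal_span [set x * y | x in I & y in J].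

Definition ideal_exp (A : comPzRingType) (I : set A) (n : nat) : set A :=
  iter n (ideal_mul I) setT.

Definition integral_closure (A : comPzRingType) (I : set A) : set A :=
  [set x | exists (n : nat) (a : nat -> A),
    [/\ (1 <= n)%N,
        forall i, (1 <= i <= n)%N -> ideal_exp I i (a i)
      & x ^+ n + \sum_(1 <= i < n.+1) a i * x ^+ (n - i) = 0]].

(* GRing.lreg x (injectivity of multiplication by x) says that x is a
   nonzerodivisor. *)
Definition ic (A : comPzRingType) : set (set A) :=
  [set I | [/\ is_ideal I,
               integral_closure I = I
             & exists2 x, I x & GRing.lreg x]].
Arguments ic : clear implicits.

(* Main.v *)
Require Import Defs.
From HB Require Import structures.
From mathcomp Require Import all_boot all_algebra ring.
From mathcomp Require Import boolp classical_sets.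

(** An element [x] is integral over a regular ideal [I] if and only if
    [x M] is contained in [I M] for some regular ideal [M]: given an equation
    of degree [n], take [M = (I + (x))^(n-1)]; conversely use the determinant
    trick on generators of [M].  Replacing [M] by a product of such ideals,
    one [M] serves finitely many elements, hence, by noetherianity, the whole
    integral closure of [I].  Everything follows from this; for instance, if
    [I J] lies in the closure of [I K], then [J (I M)] lies in [I K M], which
    is [K (I M)], so [J] is integral over [K]. *)

Set Implicit Arguments.
Unset Strict Implicit.
Unset Printing Implicit Defensive.

Import GRing.Theory.
Local Open Scope classical_set_scope.
Local Open Scope ring_scope.

(** * Products and powers of ideals, regular ideals *)

Definition regular (A : comPzRingType) (I : set A) : Prop :=
  exists2 c, I c & GRing.lreg c.

Lemma is_ideal_span (A : comPzRingType) (S : set A) : is_ideal (ideal_span S).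
Proof.
split=> [J [[]] //|x y Sx Sy J JS|a x Sx J JS]; have [[J0 JD JM] SJ] := JS.
- by apply: JD; [apply: Sx | apply: Sy].
- by apply: JM; apply: Sx.
Qed.

Lemma ideal_span_min (A : comPzRingType) (S J : set A) :
  is_ideal J -> S `<=` J -> ideal_span S `<=` J.
Proof. by move=> Jid SJ x; apply. Qed.

Lemma is_ideal_setT (A : comPzRingType) : is_ideal (@setT A).
Proof. by []. Qed.

(** With one factor fixed, membership of a product in an ideal becomes an ideal in the other factor,
    so it can be checked on generators by [ideal_span_min] or [ideal_mul_min]. *)
Lemma is_ideal_preim (A : comPzRingType) (I : set A) (c : A) :
  is_ideal I -> is_ideal [set x | I (c * x)].
Proof.
move=> [I0 ID IM]; split=> [|x y|a x] /=; first by rewrite mulr0.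
- by rewrite mulrDr; apply: ID.
- by rewrite mulrCA; apply: IM.
Qed.

Lemma is_ideal_mul (A : comPzRingType) (I J : set A) : is_ideal (ideal_mul I J).
Proof. exact: is_ideal_span. Qed.

Lemma mem_ideal_mul (A : comPzRingType) (I J : set A) (x y : A) :
  I x -> J y -> ideal_mul I J (x * y).
Proof. by move=> Ix Jy K [_]; apply; exists x => //; exists y. Qed.

Lemma ideal_mul_min (A : comPzRingType) (I J K : set A) :
    is_ideal K -> (forall x y, I x -> J y -> K (x * y)) ->
  ideal_mul I J `<=` K.
Proof.
by move=> Kid IJK; apply: ideal_span_min => // _ [x Ix [y Jy <-]]; apply: IJK.
Qed.

Lemma ideal_mulS (A : comPzRingType) (I I' J J' : set A) :
  I `<=` I' -> J `<=` J' -> ideal_mul I J `<=` ideal_mul I' J'.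
Proof.
move=> II' JJ'; apply: ideal_mul_min => [|x y /II' Ix /JJ' Jy].
  exact: is_ideal_mul.
exact: mem_ideal_mul.
Qed.

Lemma ideal_mulC (A : comPzRingType) (I J : set A) :
  ideal_mul I J = ideal_mul J I.
Proof.
wlog suff: I J / ideal_mul I J `<=` ideal_mul J I.
  by move=> IJ; apply/seteqP; split; apply: IJ.
apply: ideal_mul_min => [|x y Ix Jy]; first exact: is_ideal_mul.
by rewrite mulrC; apply: mem_ideal_mul.
Qed.

Lemma ideal_mulA (A : comPzRingType) (I J K : set A) :
  ideal_mul I (ideal_mul J K) = ideal_mul (ideal_mul I J) K.
Proof.
(* Commutativity turns this inclusion, with [I] and [K] exchanged, into the reverse one. *)
wlog suff IJK : I J K /
    ideal_mul I (ideal_mul J K) `<=` ideal_mul (ideal_mul I J) K.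
  apply/seteqP; split; first exact: IJK.
  rewrite (ideal_mulC I (ideal_mul J K)) (ideal_mulC J K).
  by rewrite (ideal_mulC _ K) (ideal_mulC I J); apply: IJK.
apply: ideal_mul_min => [|x w Ix]; first exact: is_ideal_mul.
suff: ideal_mul J K `<=` [set w | ideal_mul (ideal_mul I J) K (x * w)] by apply.
apply: ideal_mul_min; first by apply: is_ideal_preim; apply: is_ideal_mul.
by move=> y z Jy Kz /=; rewrite mulrA; do 2?apply: mem_ideal_mul.
Qed.

Lemma ideal_mulT (A : comPzRingType) (I : set A) :
  is_ideal I -> ideal_mul I setT = I.
Proof.
move=> Iid; apply/seteqP; split=> [|x Ix].
  apply: ideal_mul_min => // x y Ix _.
  by case: Iid => _ _ IM; rewrite mulrC; apply: IM.
by rewrite -[x]mulr1; apply: mem_ideal_mul.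
Qed.

Lemma regular_mul (A : comPzRingType) (I J : set A) :
  regular I -> regular J -> regular (ideal_mul I J).
Proof.
move=> [c Ic cr] [d Jd dr]; exists (c * d); first exact: mem_ideal_mul.
exact: lregM.
Qed.

Lemma regularS (A : comPzRingType) (I J : set A) :
  I `<=` J -> regular I -> regular J.
Proof. by move=> IJ [c /IJ Jc cr]; exists c. Qed.

Lemma regularT (A : comPzRingType) : regular (@setT A).
Proof. by exists 1 => //; apply: lreg1. Qed.

Lemma is_ideal_exp (A : comPzRingType) (I : set A) (n : nat) :
  is_ideal (ideal_exp I n).
Proof. by case: n => [|n]; [apply: is_ideal_setT | apply: is_ideal_mul]. Qed.

Lemma regular_exp (A : comPzRingType) (I : set A) (n : nat) :
  regular I -> regular (ideal_exp I n).
Proof.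
by move=> Ir; elim: n => [|n IHn]; [apply: regularT | apply: regular_mul].
Qed.

Lemma ideal_exp1 (A : comPzRingType) (I : set A) :
  is_ideal I -> ideal_exp I 1 = I.
Proof. exact: ideal_mulT. Qed.

Lemma ideal_expS (A : comPzRingType) (I J : set A) (n : nat) :
  I `<=` J -> ideal_exp I n `<=` ideal_exp J n.
Proof. by move=> IJ; elim: n => // n IHn; apply: ideal_mulS. Qed.

Lemma ideal_expD (A : comPzRingType) (I : set A) (m n : nat) :
  ideal_mul (ideal_exp I m) (ideal_exp I n) = ideal_exp I (m + n).
Proof.
elim: m => [|m IHm]; last by rewrite addSn -[LHS]ideal_mulA IHm.
by rewrite ideal_mulC ideal_mulT //; apply: is_ideal_exp.
Qed.

Lemma mem_ideal_exp (A : comPzRingType) (I : set A) (x : A) (n : nat) :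
  I x -> ideal_exp I n (x ^+ n).
Proof.
move=> Ix; elim: n => [|n IHn] //.
by rewrite exprS; apply: mem_ideal_mul.
Qed.

Lemma ideal_sum (A : comPzRingType) (I : set A) (T : Type) (r : seq T)
    (P : pred T) (F : T -> A) :
  is_ideal I -> (forall i, P i -> I (F i)) -> I (\sum_(i <- r | P i) F i).
Proof. by move=> [I0 ID _] IF; apply: big_ind => // *; apply: ID. Qed.

(** * Sums of ideals and principal ideals *)

Definition ideal_add (A : comPzRingType) (I J : set A) : set A :=
  [set z | exists x y, [/\ I x, J y & z = x + y]].

Lemma is_ideal_add (A : comPzRingType) (I J : set A) :
  is_ideal I -> is_ideal J -> is_ideal (ideal_add I J).
Proof.
move=> [I0 ID IM] [J0 JD JM]; split=> [|_ z [x [y [Ix Jy ->]]]|a z].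
- by exists 0, 0; rewrite addr0.
- move=> [x' [y' [Ix' Jy' ->]]]; exists (x + x'), (y + y').
  by rewrite addrACA; split=> //; [apply: ID | apply: JD].
- move=> [x [y [Ix Jy ->]]]; exists (a * x), (a * y).
  by rewrite mulrDr; split=> //; [apply: IM | apply: JM].
Qed.

Definition principal (A : comPzRingType) (x : A) : set A :=
  [set y | exists c, y = c * x].

Lemma is_ideal_principal (A : comPzRingType) (x : A) : is_ideal (principal x).
Proof.
split=> [|_ _ [c ->] [d ->]|a _ [c ->]]; first by exists 0; rewrite mul0r.
- by exists (c + d); rewrite mulrDl.
- by exists (a * c); rewrite mulrA.
Qed.

(** * Lower terms of integral equations *)

(* The values at [x] of the polynomials [a_1 X^(n-1) + ... + a_n] with [a_i] in
   [I^i], so that [x] is integral over [I] iff [- x ^+ n] lies in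
   [lower_terms I x n] for some [n > 0]. *)
Definition lower_terms (A : comPzRingType) (I : set A) (x : A) (n : nat) :
    set A :=
  [set z | exists2 a : nat -> A,
     forall i, (1 <= i <= n)%N -> ideal_exp I i (a i)
     & z = \sum_(1 <= i < n.+1) a i * x ^+ (n - i)].

Lemma is_ideal_lower_terms (A : comPzRingType) (I : set A) (x : A) (n : nat) :
  is_ideal (lower_terms I x n).
Proof.
split=> [|_ _ [a Ia ->] [b Ib ->]|c _ [a Ia ->]].
- exists (fun=> 0) => [i _|]; first by case: (is_ideal_exp I i).
  by rewrite big1 // => i _; rewrite mul0r.
- exists (fun i => a i + b i) => [i le_i|].
    by case: (is_ideal_exp I i) => _ ID _; apply: ID; [apply: Ia | apply: Ib].
  by rewrite -big_split; apply: eq_bigr => i _; rewrite mulrDl.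
- exists (fun i => c * a i) => [i le_i|].
    by case: (is_ideal_exp I i) => _ _ IM; apply: IM; apply: Ia.
  by rewrite mulr_sumr; apply: eq_bigr => i _; rewrite mulrA.
Qed.

Lemma lower_termsX (A : comPzRingType) (I : set A) (x z : A) (n : nat) :
  lower_terms I x n z -> lower_terms I x n.+1 (z * x).
Proof.
(* Nothing is known about [a n.+1], so the new constant coefficient is set to 0. *)
move=> [a Ia ->]; exists (fun i => if (i <= n)%N then a i else 0) => [i|].
  case: ifP => [le_in /andP[i0 _]|_ _]; first by apply: Ia; rewrite i0.
  by case: (is_ideal_exp I i).
rewrite [RHS]big_nat_recr //= ltnn mul0r addr0 mulr_suml.
rewrite [LHS]big_nat_cond [RHS]big_nat_cond; apply: eq_bigr => i.
by rewrite andbT => /andP[_ le_in]; rewrite -ltnS le_in subSn // exprSr mulrA.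
Qed.

Lemma lower_termsM (A : comPzRingType) (I : set A) (x z b : A) (n : nat) :
  I b -> lower_terms I x n z -> lower_terms I x n.+1 (b * z).
Proof.
move=> Ib [a Ia ->].
exists (fun i => if (1 < i)%N then b * a i.-1 else 0) => [[|[|i]] //= le_i|].
- by case: (is_ideal_exp I 1).
- by apply: mem_ideal_mul (Ia i.+1 _).
rewrite [RHS]big_nat_recl //= mul0r add0r mulr_sumr.
rewrite [LHS]big_nat_cond [RHS]big_nat_cond; apply: eq_bigr => i.
by rewrite andbT => /andP[i0 _]; rewrite ltnS i0 subSS mulrA.
Qed.

Lemma lower_terms_head (A : comPzRingType) (I : set A) (x b : A) (n : nat) :
  is_ideal I -> I b -> lower_terms I x n.+1 (b * x ^+ n).
Proof.
move=> Iid Ib; exists (fun i => if i == 1 then b else 0) => [[|[|i]] //= _|].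
- by rewrite ideal_mulT.
- by case: (is_ideal_exp I i.+2).
rewrite big_nat_recl //= subSS subn0 big_nat_cond big1 ?addr0 // => i.
by rewrite andbT => /andP[i0 _]; rewrite eqSS gtn_eqF // mul0r.
Qed.

(** This bounds one term of the Leibniz expansion of a characteristic determinant. By induction on
    the number of factors: once the top term is removed, what remains is an earlier remainder times
    [x], an earlier remainder times an element of [I], or an element of [I] times [x ^+ n]. *)
Lemma lower_terms_prod (A : comPzRingType) (I : set A) (x : A) (n : nat)
    (e b : 'I_n -> A) :
    is_ideal I -> (forall i, I (b i)) ->
  lower_terms I x n (\prod_i (e i * x - b i) - (\prod_i e i) * x ^+ n).
Proof.
move=> Iid; elim: n e b => [|n IHn] e b Ib.
  by rewrite !big_ord0 mulr1 subrr; case: (is_ideal_lower_terms I x 0).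
have [_ LD LM] := is_ideal_lower_terms I x n.+1.
have {IHn}Lp := IHn (fun i => e (lift ord0 i)) _ (fun i => Ib (lift ord0 i)).
rewrite !big_ord_recl; set p := \prod_i _ in Lp *; set q := \prod_i _ in Lp *.
have -> : (e ord0 * x - b ord0) * p - e ord0 * q * x ^+ n.+1 =
    e ord0 * ((p - q * x ^+ n) * x)
    + (-1 * (b ord0 * (p - q * x ^+ n)) + - q * (b ord0 * x ^+ n)).
  by rewrite exprS; ring.
apply: (LD); first by apply: LM; apply: lower_termsX.
apply: LD; apply: LM; first exact: lower_termsM.
exact: lower_terms_head.
Qed.

Lemma integral_closureP (A : comPzRingType) (I : set A) (x : A) :
  integral_closure I x <->
  exists2 n, (0 < n)%N & lower_terms I x n (x ^+ n).
Proof.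
have LN n z : lower_terms I x n z -> lower_terms I x n (- z).
  by rewrite -mulN1r; case: (is_ideal_lower_terms I x n) => _ _; apply.
split=> [[n [a [n0 Ia]]] /eqP|[n n0 /LN[a Ia eq_x]]].
  rewrite addr_eq0 => /eqP eq_x; exists n => //; rewrite eq_x.
  by apply: LN; exists a.
by exists n, a; split=> //; rewrite -eq_x subrr.
Qed.

(** * Ideal quotients and the determinant trick *)

(* The ideal quotient (I M : M). *)
Definition mul_colon (A : comPzRingType) (I M : set A) : set A :=
  [set x | forall m, M m -> ideal_mul I M (x * m)].

Lemma is_ideal_mul_colon (A : comPzRingType) (I M : set A) :
  is_ideal (mul_colon I M).
Proof.
have [P0 PD PM] := is_ideal_mul I M.
split=> [m _|x y xM yM m Mm|a x xM m Mm]; first by rewrite mul0r.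
- by rewrite mulrDl; apply: PD; [apply: xM | apply: yM].
- by rewrite -mulrA; apply: PM; apply: xM.
Qed.

(** Multiplying [x M <= I M] by [N] preserves it, so elements with different witnesses can share the
    product of these witnesses. *)
Lemma mul_colon_mulr (A : comPzRingType) (I M N : set A) :
  mul_colon I M `<=` mul_colon I (ideal_mul M N).
Proof.
move=> x xM.
apply: ideal_mul_min; first by apply: is_ideal_preim; apply: is_ideal_mul.
move=> m n Mm Nn /=; rewrite ideal_mulA mulrA.
exact: mem_ideal_mul (xM _ Mm) Nn.
Qed.

Lemma mul_colon_mull (A : comPzRingType) (I M N : set A) :
  mul_colon I N `<=` mul_colon I (ideal_mul M N).
Proof. by rewrite ideal_mulC; apply: mul_colon_mulr. Qed.

Lemma integral_closure_colon (A : comPzRingType) (I : set A) (x : A) :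
    is_ideal I -> regular I -> integral_closure I x ->
  exists M, [/\ is_ideal M, regular M & mul_colon I M x].
Proof.
move=> Iid Ir /integral_closureP[[//|n] _ [a Ia eq_x]].
have [I0 _ _] := Iid; have [X0 _ _] := is_ideal_principal x.
pose L := ideal_add I (principal x).
have sIL : I `<=` L by move=> y Iy; exists y, 0; rewrite addr0.
have Lx : L x.
  by exists 0, x; rewrite add0r; split=> //; exists 1; rewrite mul1r.
(* Since [L = I + (x)], any product of [k.+1] elements of [L] with a factor in [I] falls into
   [I L^k]; only multiples of [x ^+ k.+1] escape. *)
have LexpS k : ideal_exp L k.+1 `<=`
    ideal_add (ideal_mul I (ideal_exp L k)) (principal (x ^+ k.+1)).
  elim: k => [|k IHk].
    rewrite ideal_exp1 ?expr1 ?ideal_mulT //.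
    by apply: is_ideal_add => //; apply: is_ideal_principal.
  have Wid : is_ideal (ideal_add (ideal_mul I (ideal_exp L k.+1))
                                 (principal (x ^+ k.+2))).
    by apply: is_ideal_add; [apply: is_ideal_mul | apply: is_ideal_principal].
  have [W0 WD WM] := Wid.
  apply: ideal_mul_min => // y _ Ly /IHk[u [_ [ILu [c ->] ->]]].
  rewrite mulrDr; apply: WD.
    exists (y * u), 0; rewrite addr0; split=> //; last first.
      by case: (is_ideal_principal (x ^+ k.+2)).
    rewrite -/(ideal_exp L k.+1) /= ideal_mulA (ideal_mulC I) -ideal_mulA.
    exact: mem_ideal_mul.
  case: Ly => [b [_ [Ib [d ->] ->]]]; rewrite mulrCA; apply: WM.
  exists (b * x ^+ k.+1), (d * x ^+ k.+2); split; last 1 first.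
  - by rewrite mulrDl -mulrA -exprS.
  - by apply: mem_ideal_mul => //; apply: mem_ideal_exp.
  - by exists d.
exists (ideal_exp L n); split; first exact: is_ideal_exp.
  by apply: regular_exp; apply: regularS Ir.
move=> m Lm; have /LexpS[u [_ [ILu [c ->] ->]]] : ideal_exp L n.+1 (x * m).
  exact: mem_ideal_mul.
have [_ PD PM] := is_ideal_mul I (ideal_exp L n).
(* The equation has degree [n.+1], so it rewrites exactly the escaping power [x ^+ n.+1]. *)
apply: PD => //; apply: PM; rewrite eq_x big_nat_cond.
apply: ideal_sum => [|i]; first exact: is_ideal_mul.
rewrite andbT => /andP[i_gt0 le_in].
(* As [i > 0], one factor [I] can be split off [I^i]; the other [i - 1] are enlarged to [L], which
   leaves [I L^n]. *)
have := mem_ideal_mul (Ia i _) (@mem_ideal_exp _ _ x (n.+1 - i) Lx).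
rewrite i_gt0 => /(_ le_in); case: i i_gt0 le_in => // i _ le_in.
rewrite -[ideal_exp I i.+1]/(ideal_mul I (ideal_exp I i)) -ideal_mulA.
apply: ideal_mulS => // y.
move=> /(ideal_mulS (@ideal_expS _ _ _ i sIL) (@subset_refl _ _)).
by rewrite ideal_expD subSS subnKC.
Qed.

Lemma ideal_mul_spanP (A : comPzRingType) (I : set A) (s : seq A) :
    is_ideal I ->
  ideal_mul I (ideal_span [set` s]) `<=`
  [set z | exists2 b : 'I_(size s) -> A, forall i, I (b i)
                                       & z = \sum_i b i * s`_i].
Proof.
move=> Iid; have [I0 ID IM] := Iid; set T := (X in _ `<=` X).
have Tid : is_ideal T.
  split=> [|_ _ [b Ib ->] [c Ic ->]|d _ [b Ib ->]].
  - by exists (fun=> 0) => //; rewrite big1 // => i _; rewrite mul0r.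
  - exists (fun i => b i + c i) => [i|]; first exact: ID.
    by rewrite -big_split; apply: eq_bigr => i _; rewrite mulrDl.
  - exists (fun i => d * b i) => [i|]; first exact: IM.
    by rewrite mulr_sumr; apply: eq_bigr => i _; rewrite mulrA.
apply: ideal_mul_min => // x y Ix.
apply: (ideal_span_min (is_ideal_preim x Tid)) => z /= zs.
have lt_z : (index z s < size s)%N by rewrite index_mem.
(* The list may repeat [z], so the coefficient [x] is put at its first occurrence only. *)
exists (fun i => if i == Ordinal lt_z then x else 0) => [i|].
  by case: ifP.
rewrite (bigD1 (Ordinal lt_z)) //= eqxx nth_index // big1 ?addr0 // => i.
by move=> /negPf ->; rewrite mul0r.
Qed.

Lemma mul_colon_integral (A : comPzRingType) (I M : set A) (x : A) :
    noetherian A -> is_ideal I -> is_ideal M -> regular M ->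
  mul_colon I M x -> integral_closure I x.
Proof.
move=> hA Iid /hA[s ->] [c sc cr] xM; pose n := size s.
have sM i : (i < n)%N -> ideal_span [set` s] s`_i.
  by move=> lt_in J [_ sJ]; apply: sJ => /=; apply: mem_nth.
have /choice[B BP] (i : 'I_n) : exists b : 'I_n -> A,
    (forall j, I (b j)) /\ x * s`_i = \sum_j b j * s`_j.
  have /ideal_mul_spanP[//|b Ib eqb] := xM _ (sM i (ltn_ord i)).
  by exists b.
(* [C] is [x] times the identity minus [B]; it kills the column of generators of [M]. *)
pose C : 'M[A]_n := \matrix_(i, j) ((i == j)%:R * x - B i j).
have Cs0 : C *m \col_i s`_i = 0.
  apply/matrixP => i j; rewrite !mxE.
  under eq_bigr do rewrite !mxE mulrBl -mulrA mulr_natl mulrb.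
  rewrite sumrB -big_mkcond /= (eq_bigl (pred1 i)) => [|k]; last exact: eq_sym.
  by rewrite big_pred1_eq (BP i).2 subrr.
(* Through the adjugate, [\det C] kills every generator, hence all of [M], in particular its
   nonzerodivisor [c]. *)
have det0 : \det C = 0.
  apply: cr; rewrite mulr0 mulrC.
  suff /(_ c sc) : ideal_span [set` s] `<=` [set y | \det C * y = 0] by [].
  apply: ideal_span_min => [|y /= /(nthP 0)[i lt_is <-]].
    split=> [|y z /= dy dz|a y /= dy]; first by rewrite /= mulr0.
    - by rewrite mulrDr dy dz addr0.
    - by rewrite mulrCA dy mulr0.
  have /matrixP/(_ (Ordinal lt_is) 0) := congr1 (mulmx (\adj C)) Cs0.
  by rewrite mulmxA mul_adj_mx mul_scalar_mx mulmx0 !mxE.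
(* Keeping [\det 1%:M] unevaluated lets the two determinants be compared permutation by
   permutation. *)
have Ldet : lower_terms I x n (\det C - \det (1%:M : 'M[A]_n) * x ^+ n).
  have [_ _ LM] := is_ideal_lower_terms I x n.
  rewrite /determinant mulr_suml -sumrB.
  apply: ideal_sum => [|w _]; first exact: is_ideal_lower_terms.
  rewrite -mulrA -mulrBr; apply: LM.
  under eq_bigr do rewrite mxE.
  under [X in X * x ^+ n]eq_bigr do rewrite mxE.
  by apply: lower_terms_prod => // i; apply: (BP i).1.
have Lx : lower_terms I x n (x ^+ n).
  move: Ldet; rewrite det0 det1 mul1r sub0r => Lx.
  rewrite -[_ ^+ _]opprK -mulN1r.
  by case: (is_ideal_lower_terms I x n) => _ _; apply.
(* The list of generators may be empty; the extra factor [x] makes the degree positive. *)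
apply/integral_closureP; exists n.+1 => //.
by rewrite exprSr; apply: lower_termsX.
Qed.

(** * Integral closures of regular ideals *)

Lemma sub_integral_closure (A : comPzRingType) (I : set A) :
  is_ideal I -> I `<=` integral_closure I.
Proof.
move=> Iid x Ix; apply/integral_closureP; exists 1 => //.
by rewrite -[x ^+ 1]mulr1; apply: lower_terms_head.
Qed.

Lemma integral_closureS (A : comPzRingType) (I J : set A) :
  I `<=` J -> integral_closure I `<=` integral_closure J.
Proof.
move=> IJ x [n [a [n0 Ia eq_x]]]; exists n, a; split=> // i le_i.
by apply: ideal_expS (Ia i le_i).
Qed.

Lemma is_ideal_integral_closure (A : comPzRingType) (I : set A) :
    noetherian A -> is_ideal I -> regular I ->
  is_ideal (integral_closure I).
Proof.
move=> hA Iid Ir; have [I0 _ _] := Iid.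
split=> [|x y|a x]; first exact: sub_integral_closure.
- move=> /integral_closure_colon[]// M [Mid Mr xM].
  move=> /integral_closure_colon[]// N [Nid Nr yN].
  apply: (@mul_colon_integral _ _ (ideal_mul M N)) => //.
  + exact: is_ideal_mul.
  + exact: regular_mul.
  (* Both [x] and [y] lie in the ideal [(I M N : M N)], hence so does their sum. *)
  + case: (is_ideal_mul_colon I (ideal_mul M N)) => _ + _; apply.
      exact: mul_colon_mulr.
    exact: mul_colon_mull.
- move=> /integral_closure_colon[]// M [Mid Mr xM].
  apply: mul_colon_integral Mid Mr _ => //.
  by case: (is_ideal_mul_colon I M) => _ _; apply.
Qed.

Lemma integral_closure_sub_colon (A : comPzRingType) (I : set A) :
    noetherian A -> is_ideal I -> regular I ->
  exists M, [/\ is_ideal M, regular M & integral_closure I `<=` mul_colon I M].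
Proof.
(* The closure is already known to be an ideal, so it has finitely many generators; the product of
   their witnesses serves them all. *)
move=> hA Iid Ir; have [s eq_s] := hA _ (is_ideal_integral_closure hA Iid Ir).
have [M [Mid Mr sM]] : exists M,
    [/\ is_ideal M, regular M & [set` s] `<=` mul_colon I M].
  have: [set` s] `<=` integral_closure I by rewrite eq_s => x sx J [_]; apply.
  elim: s {eq_s} => [|x s IHs] sI.
    by exists setT; split=> //; apply: regularT.
  have [|M [Mid Mr sM]] := IHs.
    by move=> y /= ys; apply: sI; rewrite /= inE ys orbT.
  have [|N [Nid Nr xN]] := @integral_closure_colon _ I x Iid Ir.
    by apply: sI; rewrite /= inE eqxx.
  exists (ideal_mul M N); split; [exact: is_ideal_mul | exact: regular_mul |].
  move=> y /=; rewrite inE => /predU1P[->|ys]; first exact: mul_colon_mull.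
  by apply: mul_colon_mulr; apply: sM.
exists M; split=> //; rewrite eq_s.
by apply: ideal_span_min => //; apply: is_ideal_mul_colon.
Qed.

Lemma integral_closure_id (A : comPzRingType) (I : set A) :
    noetherian A -> is_ideal I -> regular I ->
  integral_closure (integral_closure I) = integral_closure I.
Proof.
move=> hA Iid Ir; have Cid := is_ideal_integral_closure hA Iid Ir.
have sIC := sub_integral_closure Iid.
apply/seteqP; split; last exact: sub_integral_closure.
move=> x /integral_closure_colon[]//; first exact: regularS Ir.
move=> N [Nid Nr xN].
have [M [Mid Mr CM]] := integral_closure_sub_colon hA Iid Ir.
apply: (@mul_colon_integral _ _ (ideal_mul M N)) => //.
- exact: is_ideal_mul.
- exact: regular_mul.
(* With [C] the closure of [I], the chain is [x M N <= C M N <= I M N]. *)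
move=> m /(mul_colon_mull xN).
apply: ideal_mul_min => [|y w /CM yM]; first exact: is_ideal_mul.
exact: mul_colon_mulr.
Qed.

(** This gives associativity of the closed product. If [x M <= I M] and [y] is in [J], then
    [x y M <= I J M], so the product of the closure of [I] with [J] is integral over [I J];
    idempotence of the closure does the rest. *)
Lemma integral_closure_mull (A : comPzRingType) (I J : set A) :
    noetherian A -> is_ideal I -> regular I -> regular J ->
  integral_closure (ideal_mul (integral_closure I) J) =
  integral_closure (ideal_mul I J).
Proof.
move=> hA Iid Ir Jr.
have IJid := is_ideal_mul I J; have IJr := regular_mul Ir Jr.
apply/seteqP; split; last first.
  by apply: integral_closureS; apply: ideal_mulS (sub_integral_closure Iid) _.
rewrite -[X in _ `<=` X]integral_closure_id //; apply: integral_closureS.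
apply: ideal_mul_min; first exact: is_ideal_integral_closure.
move=> x y /integral_closure_colon[]// M [Mid Mr xM] Jy.
apply: mul_colon_integral Mid Mr _ => // m /xM IMxm.
rewrite mulrAC (ideal_mulC I) -ideal_mulA mulrC.
exact: mem_ideal_mul.
Qed.

Lemma integral_closure_mul_cancel (A : comPzRingType) (I J K : set A) :
    noetherian A -> is_ideal I -> regular I -> is_ideal K -> regular K ->
    ideal_mul I J `<=` integral_closure (ideal_mul I K) ->
  J `<=` integral_closure K.
Proof.
move=> hA Iid Ir Kid Kr IJK y Jy.
have [M [Mid Mr CM]] :=
  integral_closure_sub_colon hA (is_ideal_mul I K) (regular_mul Ir Kr).
(* The ideal to be cancelled is absorbed into the witness, which stays regular because [I] is. *)
apply: (@mul_colon_integral _ _ (ideal_mul I M)) => //.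
- exact: is_ideal_mul.
- exact: regular_mul.
apply: ideal_mul_min; first by apply: is_ideal_preim; apply: is_ideal_mul.
move=> i m Ii Mm /=; rewrite ideal_mulA (ideal_mulC K) mulrA (mulrC y).
exact: CM (IJK _ (mem_ideal_mul Ii Jy)) _ Mm.
Qed.

(** * The monoid of integrally closed regular ideals *)

Lemma ic_setT (A : comPzRingType) : ic A setT.
Proof.
split; [exact: is_ideal_setT | | exact: regularT].
by apply/seteqP; split=> //; apply/sub_integral_closure/is_ideal_setT.
Qed.

Lemma ic_integral_closure_mul (A : comPzRingType) (I J : set A) :
  noetherian A -> ic A I -> ic A J -> ic A (integral_closure (ideal_mul I J)).
Proof.
move=> hA [Iid _ Ir] [Jid _ Jr].
have IJid := is_ideal_mul I J; have IJr := regular_mul Ir Jr.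
split; [exact: is_ideal_integral_closure | exact: integral_closure_id |].
by apply: regularS IJr; apply: sub_integral_closure.
Qed.

Theorem theorem2p1 (A : comPzRingType) (hA : noetherian A) :
  exists (one : ic A) (mul : Monoid.com_law one),
    (forall I J : ic A,
       sval (mul I J) = integral_closure (ideal_mul (sval I) (sval J))) /\
    (forall I J K : ic A, mul I J = mul I K -> J = K).
Proof.
have icP (I : ic A) : ic A (sval I) by apply: set_mem (svalP I).
pose one : ic A := exist _ setT (mem_set (@ic_setT A)).
pose op (I J : ic A) : ic A :=
  exist _ (integral_closure (ideal_mul (sval I) (sval J)))
    (mem_set (ic_integral_closure_mul hA (icP I) (icP J))).
have opA : associative op.
  move=> I J K; apply: val_inj => /=.
  have [[Iid _ Ir] [Jid _ Jr] [Kid _ Kr]] := And3 (icP I) (icP J) (icP K).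
  (* Commuting the left side puts the inner closure first; both sides then become closures of triple
     products. *)
  rewrite ideal_mulC !integral_closure_mull //;
    do ?[exact: is_ideal_mul | exact: regular_mul].
  by rewrite ideal_mulC ideal_mulA.
have opC : commutative op.
  by move=> I J; apply: val_inj => /=; rewrite ideal_mulC.
have op1 : left_id one op.
  move=> I; apply: val_inj => /=; have [Iid Icl _] := icP I.
  by rewrite ideal_mulC ideal_mulT.
exists one, (HB.pack_for (Monoid.com_law one) op
  (Monoid.isComLaw.Build _ one op opA opC op1)).
split=> // I J K /(congr1 val) /= eqJK; apply: val_inj.
have [[Iid _ Ir] [Jid Jcl Jr] [Kid Kcl Kr]] := And3 (icP I) (icP J) (icP K).
(* [I J] lies in its closure, which equals that of [I K]; cancelling [I] puts [J] in the closure of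
   [K], that is in [K]. The other inclusion is symmetric. *)
apply/seteqP; split.
  rewrite -[X in _ `<=` X]Kcl.
  apply: (integral_closure_mul_cancel (I := sval I)) => //.
  by rewrite -eqJK; apply: sub_integral_closure; apply: is_ideal_mul.
rewrite -[X in _ `<=` X]Jcl.
apply: (integral_closure_mul_cancel (I := sval I)) => //.
by rewrite eqJK; apply: sub_integral_closure; apply: is_ideal_mul.
Qed.
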